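(* Let $(p_n)_{n \ge 1}$ and $(q_n)_{n \ge 1}$ be strictly increasing sequences of primes with $100 < q_1$ and $q_n < p_n < q_{n+1}$ for all $n \in \mathbb{N}$, and set $\alpha_n := q_n/p_n$; assume $\alpha_1 < \frac{1}{200}$ and $\alpha_{n+1} < \frac12 \alpha_n$ for all $n$. Let $A_2 := \{\alpha_{j_k} + \sum_{i=1}^{\ell} \alpha_{j_i} : \ell \in \mathbb{N},\ k \in \{1,\dots,\ell\},\ j_1,\dots,j_\ell \in \mathbb{N} \text{ distinct}\}$, $A_3 := \{2\alpha_{j_k} + \sum_{i=1}^{\ell} \alpha_{j_i} : \ell \in \mathbb{N},\ k \in \{1,\dots,\ell\},\ j_1,\dots,j_\ell \in \mathbb{N} \text{ distinct}\}$, $B := \{\beta_0 := 1\} \cup \{\beta_\ell := 1 - \sum_{i=1}^\ell \alpha_i : \ell \in \mathbb{N}\}$, and let $M$ be the additive submonoid of $\mathbb{Q}$ generated by $A_2 \cup A_3 \cup B$. Then for every field $F$, the monoid algebra $F[M]$ satisfies the almost ACCP.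
   Context: $F[M]$ is the integral domain of polynomial expressions $\sum c_i x^{m_i}$ with $c_i \in F$, $m_i \in M$. An element of a (cancellative commutative) monoid $H$ is atomic if it is a unit or a finite product of atoms (non-units $a$ such that $a = bc$ forces $b$ or $c$ to be a unit). An element $b$ satisfies the ACCP if every ascending chain of principal ideals starting at $bH$ stabilizes. $H$ satisfies the almost ACCP if for every finite nonempty $S \subseteq H$ there exist an atomic common divisor $d$ of $S$ in $H$ and $s \in S$ such that $s/d$ satisfies the ACCP. An integral domain satisfies the almost ACCP if its multiplicative monoid of nonzero elements does. *)

(* Defs.v *)
From HB Require Import structures.
From mathcomp Require Import all_boot all_order all_algebra.
From mathcomp Require Import finmap.
From mathcomp Require Import monalg.
Set Implicit Arguments. Unset Strict Implicit. Unset Printing Implicit Defensive.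
Import Order.TTheory GRing.Theory Num.Theory.
Local Open Scope ring_scope.

Definition qnn := {q : rat | 0 <= q}.
HB.instance Definition _ := [isSub for (@sval rat (fun q => 0 <= q))].
HB.instance Definition _ := [Choice of qnn by <:].

Definition qnn0 : qnn := exist _ 0 (lexx 0).
Definition qnn_add (x y : qnn) : qnn :=
  exist _ (sval x + sval y) (addr_ge0 (svalP x) (svalP y)).

Lemma qnn_addA : associative qnn_add.
Proof. by move=> x y z; apply: val_inj; rewrite /= addrA. Qed.
Lemma qnn_add0 : left_id qnn0 qnn_add.
Proof. by move=> x; apply: val_inj; rewrite /= add0r. Qed.
Lemma qnn_addr0 : right_id qnn0 qnn_add.
Proof. by move=> x; apply: val_inj; rewrite /= addr0. Qed.
Lemma qnn_unit (x y : qnn) : qnn_add x y = qnn0 -> x = qnn0 /\ y = qnn0.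
Proof.
case: x y => [x hx] [y hy] /(congr1 val) /= /eqP.
rewrite paddr_eq0 // => /andP[/eqP x0 /eqP y0].
by split; apply: val_inj.
Qed.
Lemma qnn_addC : commutative qnn_add.
Proof. by move=> x y; apply: val_inj; rewrite /= addrC. Qed.

HB.instance Definition _ :=
  Choice_isMonomialDef.Build qnn qnn_addA qnn_add0 qnn_addr0 qnn_unit.
HB.instance Definition _ := MonomialDef_isConomialDef.Build qnn qnn_addC.

Definition QAlg (F : fieldType) := {malg F[qnn]}.

Inductive gen_submonoid (G : rat -> Prop) : rat -> Prop :=
| gsm0 : gen_submonoid G 0
| gsm_gen x : G x -> gen_submonoid G x
| gsm_add x y : gen_submonoid G x -> gen_submonoid G y -> gen_submonoid G (x + y).

(* The monoid algebra F[M] for an additive submonoid M of Q_{>=0}, viewed as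
   the subring of F[Q_{>=0}] of elements whose exponents all lie in M. *)
Definition in_monoid_alg (F : fieldType) (M : rat -> Prop) (f : QAlg F) : Prop :=
  forall k : qnn, k \in msupp f -> M (sval k).

(* Monoid-theoretic notions for a multiplicative monoid H given as a subset *)
(* of a commutative ring R (here: the nonzero elements of a subring).       *)
Section MonoidNotions.
Variables (R : comRingType) (H : R -> Prop).

Definition dvdH (a b : R) : Prop := exists2 c, H c & b = a * c.
Definition unitH (u : R) : Prop := H u /\ exists2 v, H v & u * v = 1.
Definition atomH (a : R) : Prop :=
  H a /\ ~ unitH a /\
  forall b c, H b -> H c -> a = b * c -> unitH b \/ unitH c.
Definition atomicH (a : R) : Prop :=
  H a /\ (unitH a \/ exists s : seq R,
     s != [::] /\ (forall x, x \in s -> atomH x) /\ a = \prod_(x <- s) x).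
Definition accpH (b : R) : Prop :=
  forall x : nat -> R, (forall n, H (x n)) -> x 0%N = b ->
    (forall n, dvdH (x n.+1) (x n)) ->
    exists N, forall n, (N <= n)%N -> dvdH (x n) (x N) /\ dvdH (x N) (x n).
Definition almost_ACCP : Prop :=
  forall S : seq R, S != [::] -> (forall s, s \in S -> H s) ->
    exists d, [/\ atomicH d, (forall s, s \in S -> dvdH d s) &
      exists2 s, s \in S & exists2 c, H c /\ s = d * c & accpH c].
End MonoidNotions.

Definition monoid_alg_almost_ACCP (F : fieldType) (M : rat -> Prop) : Prop :=
  @almost_ACCP (QAlg F) (fun f => in_monoid_alg M f /\ f != 0).

(* Data of Theorem 5.13 (0-based indexing: p i, q i, alpha i stand for     *)
(* p_{i+1}, q_{i+1}, alpha_{i+1} of the paper).                            *)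
Definition alpha (p q : nat -> nat) (i : nat) : rat := (q i)%:R / (p i)%:R.

Definition A2 (p q : nat -> nat) (x : rat) : Prop :=
  exists s : seq nat, exists2 j, j \in s &
    uniq s /\ x = alpha p q j + \sum_(i <- s) alpha p q i.

Definition A3 (p q : nat -> nat) (x : rat) : Prop :=
  exists s : seq nat, exists2 j, j \in s &
    uniq s /\ x = 2 * alpha p q j + \sum_(i <- s) alpha p q i.

Definition Bset (p q : nat -> nat) (x : rat) : Prop :=
  exists l : nat, x = 1 - \sum_(i < l) alpha p q i.

Definition Mgen (p q : nat -> nat) (x : rat) : Prop :=
  A2 p q x \/ A3 p q x \/ Bset p q x.

(* Main.v *)
(** Every element of M is a sum of betas plus a sum of alphas over a finite
    sequence [s] that is empty or repeats an index; for a bounded element and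
    [p i] large, the multiplicity of [i] in [s] (corrected by the betas) is
    determined [p i]-adically, so it behaves like a degree. Replacing
    [beta b] by [beta l] plus alphas, one divides a finite set of elements of
    M by a common multiple [k * beta l], with [k] maximal, so that some quotient
    [t] is divisible by no beta; only finitely many alphas can then divide [t].
    The atomic divisor in F[M] is the corresponding power of [X^(beta l)]; if
    some exponent is itself a beta, hence an atom, the divisor 1 will do.

    It remains to see that [f] has the ACCP as soon as some exponent [t] of [f]
    is such an element or a beta. In a factorisation of [f], a factor without constant
    term uses up a part of [t] bounded below. A factor [y] with constant term
    cannot involve [alpha i] for [i] large: ordering monomials by the exponent
    of [alpha i], the top and bottom parts of [y] and [f / y] multiply to
    parts of [f], which does not involve [alpha i]. Hence the degree of [y] is
    bounded below too, and only finitely many factors are non-units. *)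
Require Import Defs.
From HB Require Import structures.
From Stdlib Require Import Classical ClassicalEpsilon.
From mathcomp Require Import all_boot all_order all_algebra.
From mathcomp Require Import zify ring lra.
From mathcomp Require Import finmap monalg.
Import Order.TTheory GRing.Theory Num.Theory.
Set Implicit Arguments. Unset Strict Implicit. Unset Printing Implicit Defensive.
Local Open Scope ring_scope.

(** * Extremal elements of finite sequences *)

Lemma eq_of_le_of_add (O : realDomainType) (x x' y y' : O) :
  x' <= x -> y' <= y -> x' + y' = x + y -> x' = x /\ y' = y.
Proof.
move=> le_x le_y E; split; apply/eqP; rewrite eq_le ?le_x ?le_y /=.
  by rewrite -(lerD2r y) -E lerD2l.
by rewrite -(lerD2l x) -E lerD2r.
Qed.

Lemma seq_max (T : eqType) (O : realDomainType) (k : T -> O) (s : seq T) :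
  s != [::] -> exists2 m, m \in s & forall x, x \in s -> k x <= k m.
Proof.
elim: s => // x s IH _; case: (eqVneq s [::]) => [->|/IH[m ms hm]].
  by exists x; rewrite ?mem_head // => y; rewrite mem_seq1 => /eqP->.
case: (lerP (k m) (k x)) => [le_mx|/ltW le_xm].
  exists x; rewrite ?mem_head // => y; rewrite inE => /predU1P[-> //|/hm].
  by move=> h; apply: le_trans le_mx.
by exists m; rewrite ?inE ?ms ?orbT // => y; rewrite inE => /predU1P[->|/hm].
Qed.

Lemma seq_lexmax (T : eqType) (O O' : realDomainType) (k : T -> O) (k' : T -> O') (s : seq T) :
  s != [::] -> exists2 m, m \in s &
    forall x, x \in s -> k x <= k m /\ (k x = k m -> k' x <= k' m).
Proof.
move=> /(seq_max k)[m ms hm].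
have : [seq x <- s | k x == k m] != [::].
  by apply/eqP => E; have := mem_filter (fun x => k x == k m) m s; rewrite E ms eqxx.
move=> /(seq_max k')[m']; rewrite mem_filter => /andP[/eqP Em' m's] hm'.
exists m' => // x xs; rewrite Em'; split; first exact: hm.
by move=> Ex; apply: hm'; rewrite mem_filter Ex eqxx.
Qed.

(** * Supports of products in the monoid algebra *)

Section MonoidAlgebra.

Variable F : fieldType.
Implicit Types f g y z : QAlg F.

Lemma msupp_neq0 f : f != 0 -> (msupp f : seq qnn) != [::].
Proof.
apply: contraNneq => E; rewrite -msupp_eq0; apply/eqP/fsetP => k.
by rewrite in_fset0 -[k \in _]/(k \in (msupp f : seq qnn)) E.
Qed.

Lemma neq0_msupp f k : k \in msupp f -> f != 0.
Proof. by apply: contraTneq => ->; rewrite msupp0 in_fset0. Qed.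

(* No hypothesis relates the weight to the monoid law outside the two
   supports, so that it may be a p-adic invariant, additive modulo p only. *)
Lemma msupp_extremal (O : realDomainType) (w : qnn -> O) y z :
  y != 0 -> z != 0 ->
  (forall u v u' v', u \in msupp y -> v \in msupp z -> u' \in msupp y -> v' \in msupp z ->
     sval u + sval v = sval u' + sval v' -> w u + w v = w u' + w v') ->
  exists u v, [/\ u \in msupp y, v \in msupp z, mmul u v \in msupp (y * z),
     (forall u', u' \in msupp y -> w u' <= w u) & (forall v', v' \in msupp z -> w v' <= w v)].
Proof.
move=> y0 z0 hw.
(* Ties for [w] are broken by the exponent itself, so that [u] and [v] form the only pair with this
   sum and no cancellation occurs there. *)
have [u uy hu] := seq_lexmax w sval (msupp_neq0 y0).
have [v vz hv] := seq_lexmax w sval (msupp_neq0 z0).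
exists u, v; split => //; [|by move=> u' /hu[] | by move=> v' /hv[]].
have uniq_uv u' v' : u' \in msupp y -> v' \in msupp z -> mmul u' v' = mmul u v -> u' = u /\ v' = v.
  move=> u'y v'z /(congr1 sval) /= E; have Ew := hw _ _ _ _ u'y v'z uy vz E.
  have [wu su] := hu _ u'y; have [wv sv] := hv _ v'z.
  have [Eu Ev] := eq_of_le_of_add wu wv Ew.
  have [Eu' Ev'] := eq_of_le_of_add (su Eu) (sv Ev) E.
  by split; apply: val_inj.
rewrite -mcoeff_neq0 mcoeffMl (bigD1_seq u) ?fset_uniq //=.
rewrite (bigD1_seq v) ?fset_uniq //= eqxx mulr1n.
rewrite big_seq_cond big1 ?addr0 => [|v' /andP[v'z /eqP ne_v]]; last first.
  by case: eqP => // E; have [_ /ne_v] := uniq_uv _ _ uy v'z E.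
rewrite big_seq_cond big1 ?addr0 => [|u' /andP[u'y /eqP ne_u]]; last first.
  rewrite big_seq big1 // => v' v'z.
  by case: eqP => // E; have [/ne_u] := uniq_uv _ _ u'y v'z E.
by rewrite mulf_neq0 // mcoeff_neq0.
Qed.

Lemma msupp_extremal_deg y z : y != 0 -> z != 0 ->
  exists u v, [/\ u \in msupp y, v \in msupp z, mmul u v \in msupp (y * z),
     (forall u', u' \in msupp y -> sval u' <= sval u) &
     (forall v', v' \in msupp z -> sval v' <= sval v)].
Proof. by move=> y0 z0; apply: msupp_extremal. Qed.

Lemma malg_mulf_neq0 y z : y != 0 -> z != 0 -> y * z != 0.
Proof.
by move=> y0 z0; have [u [v [_ _ uv _ _]]] := msupp_extremal_deg y0 z0; apply: neq0_msupp uv.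
Qed.

(** * Units and divisibility among the nonzero elements of F[M] *)

Variable M : rat -> Prop.
Hypothesis M0 : M 0.
Hypothesis MD : forall v w : rat, M v -> M w -> M (v + w).

Definition nonzero_monoid_alg f : Prop := in_monoid_alg M f /\ f != 0.
Local Notation H := nonzero_monoid_alg.

Lemma nonzero_monoid_algM y z : H y -> H z -> H (y * z).
Proof.
move=> [My y0] [Mz z0]; split; last exact: malg_mulf_neq0.
by move=> k /msuppM_le[u [v [uy vz ->]]]; apply: MD; [apply: My | apply: Mz].
Qed.

Lemma nonzero_monoid_algC (c : F) : c != 0 -> H (c%:MP : QAlg F).
Proof.
move=> c0; split; last by rewrite monalgU_eq0.
by move=> k; rewrite msuppC (negbTE c0) in_fset1 => /eqP->.
Qed.

Lemma nonzero_monoid_alg1 : H (1 : QAlg F).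
Proof. by rewrite -mpolyC1E; apply: nonzero_monoid_algC; rewrite oner_neq0. Qed.

Lemma unitH_of_const y : H y -> (forall u, u \in msupp y -> sval u = 0) -> unitH H y.
Proof.
move=> Hy hy; have [My y0] := Hy; split => //.
have Ey : y = (y@_mone)%:MP.
  apply/malgP => k; rewrite mcoeffC; case: eqP => [-> //|ne_k].
  rewrite mulr0n; apply: mcoeff_outdom; apply/negP => /hy sk; case: ne_k.
  exact: val_inj.
have c0 : y@_mone != 0 by apply: contraNneq y0 => c0; rewrite Ey c0 monalgU0.
exists ((y@_mone)^-1)%:MP; first by apply: nonzero_monoid_algC; rewrite invr_eq0.
rewrite {1}Ey; transitivity ((y@_mone / y@_mone)%:MP : QAlg F); first by rewrite mpolyCM.
rewrite divff //; exact: mpolyC1E.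
Qed.

Lemma unitH1 : unitH H (1 : QAlg F).
Proof.
split; first exact: nonzero_monoid_alg1.
by exists 1; [exact: nonzero_monoid_alg1 | rewrite mulr1].
Qed.

Lemma dvdH_refl y : dvdH H y y.
Proof. by exists 1; [exact: nonzero_monoid_alg1 | rewrite mulr1]. Qed.

Lemma dvdH_trans f y z : dvdH H f y -> dvdH H y z -> dvdH H f z.
Proof.
by move=> [c Hc ->] [e He ->]; exists (c * e); rewrite ?mulrA //; apply: nonzero_monoid_algM.
Qed.

Lemma dvdH_unitM f y : unitH H y -> dvdH H (f * y) f.
Proof. by move=> [_ [v Hv E]]; exists v; rewrite // -mulrA E mulr1. Qed.

(** * Monomials as atoms and as divisors *)

Definition monom (d : qnn) : QAlg F := << d >>.

Lemma monom_supp d : msupp (monom d) = [fset d]%fset.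
Proof. exact: msuppU1. Qed.

Lemma nonzero_monoid_alg_monom d : M (sval d) -> H (monom d).
Proof.
move=> Md; split; first by move=> k; rewrite monom_supp in_fset1 => /eqP->.
by apply: (@neq0_msupp _ d); rewrite monom_supp in_fset1.
Qed.

Lemma monomM d e : monom d * monom e = monom (mmul d e).
Proof. by rewrite /monom [LHS]fgmulUU mulr1. Qed.

(** Top and bottom exponents of the two factors both add up to [d], hence coincide in each factor.
    So each factor has a single exponent, and the splitting of [d] makes one of the two exponents
    0. *)
Lemma atomH_monom d : M (sval d) -> sval d != 0 ->
  (forall v w, M v -> M w -> sval d = v + w -> v = 0 \/ w = 0) ->
  atomH H (monom d).
Proof.
move=> Md d0 hd; split; first exact: nonzero_monoid_alg_monom.
split.
  move=> [_ [v [_ v0] E]].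
  have /msuppM_le[u [v' [+ _ E']]] : (mone : qnn) \in msupp (monom d * v).
    by rewrite E -mcoeff_neq0 mcoeff1 eqxx oner_neq0.
  rewrite monom_supp in_fset1 => /eqP Eu; move: E' d0; rewrite Eu => /(congr1 sval) /= /esym/eqP.
  by rewrite paddr_eq0 ?(svalP d) ?(svalP v') // => /andP[-> _].
move=> y z [My y0] [Mz z0] E.
have [u [v [uy vz + hu hv]]] := msupp_extremal_deg y0 z0.
have [u' [v' [u'y v'z + hu' hv']]] := @msupp_extremal _ (fun k => - sval k) y z y0 z0
  (fun u v u' v' _ _ _ _ E => etrans (esym (opprD _ _)) (etrans (congr1 -%R E) (opprD _ _))).
rewrite -E monom_supp !in_fset1 => /eqP Ed' /eqP Ed.
have su : sval u' + sval v' = sval d by rewrite -Ed'.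
have sv : sval u + sval v = sval d by rewrite -Ed.
have [Eu Ev] := eq_of_le_of_add (hu _ u'y) (hv _ v'z) (etrans su (esym sv)).
have const_y t : t \in msupp y -> sval t = sval u.
  by move=> ty; apply/eqP; rewrite eq_le (hu _ ty) /= -Eu -lerN2; apply: hu'.
have const_z t : t \in msupp z -> sval t = sval v.
  by move=> tz; apply/eqP; rewrite eq_le (hv _ tz) /= -Ev -lerN2; apply: hv'.
have [u0|v0] := hd _ _ (My _ uy) (Mz _ vz) (esym sv); [left | right].
  by apply: unitH_of_const => // t /const_y->.
by apply: unitH_of_const => // t /const_z->.
Qed.

Lemma atomicH_monom_muln d k : atomH H (monom d) ->
  exists2 e : qnn, sval e = k%:R * sval d & atomicH H (monom e).
Proof.
move=> hd.
pose e n := iter n (mmul d) mone.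
have Ee n : sval (e n) = n%:R * sval d.
  by elim: n => [|n IH]; rewrite ?mul0r //= IH -natr1; ring.
have prodE n : monom (e n) = \prod_(x <- nseq n (monom d)) x.
  by rewrite big_nseq; elim: n => //= n <-; rewrite monomM.
exists (e k) => //; split.
  have Md : M (sval d) by case: hd => [[Md _] _]; apply: Md; rewrite monom_supp in_fset1.
  apply: nonzero_monoid_alg_monom; rewrite Ee mulr_natl; elim: k => // k IH.
  by rewrite mulrS; apply: MD.
(* [atomicH] excludes the empty product; for [k = 0] the monomial is the unit 1. *)
case: k => [|k]; first by left; apply: unitH1.
right; exists (nseq k.+1 (monom d)); split; first by [].
by split; [move=> x; rewrite mem_nseq => /andP[_ /eqP->] | exact: prodE].
Qed.

Lemma monom_factor f (d : rat) (e : qnn) : sval e = d -> f != 0 ->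
  (forall u, u \in msupp f -> 0 <= sval u - d /\ M (sval u - d)) ->
  exists2 c, H c & f = monom e * c.
Proof.
move=> Ee f0 hf.
(* Truncation at 0 makes the difference an element of [qnn] for every [u]; on the support of [f] it
   changes nothing. *)
have max_ge0 (r : rat) : 0 <= Num.max 0 r by rewrite le_max lexx.
pose sub (u : qnn) : qnn := exist _ (Num.max 0 (sval u - d)) (max_ge0 _).
have subK u : u \in msupp f -> mmul e (sub u) = u.
  move=> /hf[ge_u _]; apply: val_inj; rewrite /= Ee.
  by rewrite max_r // addrC subrK.
pose c : QAlg F := \sum_(u <- msupp f) << f@_u *g sub u >>.
have Ef : f = monom e * c.
  rewrite {1}[f]monalgE /c mulr_sumr; apply: eq_big_seq => u uf.
  by rewrite /monom [RHS]fgmulUU mul1r subK.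
exists c => //; split; last by apply: contraNneq f0 => c0; rewrite Ef c0 mulr0.
move=> k; rewrite -mcoeff_neq0 /c raddf_sum /= => /eqP ne0.
have [u uf Eu] : exists2 u, u \in msupp f & sub u = k.
  apply: NNPP => h; apply: ne0; rewrite big_seq big1 // => u uf.
  by rewrite mcoeffU; case: eqP => // E; case: h; exists u.
have [ge_u Mu] := hf u uf.
by rewrite -Eu /= max_r.
Qed.

End MonoidAlgebra.

(** * Rationals integral at a prime *)

(** For a prime [r] this is membership in the localization of the integers at [r]. *)
Definition p_integral (r : nat) (x : rat) : Prop :=
  exists2 d : nat, coprime r d & d%:R * x \is a Num.int.

Lemma p_integral_int r (x : rat) : x \is a Num.int -> p_integral r x.
Proof. by move=> xZ; exists 1%N; rewrite ?coprimen1 // mul1r. Qed.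

Lemma p_integralD r x y : p_integral r x -> p_integral r y -> p_integral r (x + y).
Proof.
move=> [d rd dx] [e re ey]; exists (d * e)%N; first by rewrite coprimeMr rd.
rewrite mulrDr natrM -mulrA rpredD //; last by rewrite -mulrA rpredM ?natr_int.
by rewrite mulrCA rpredM ?natr_int.
Qed.

Lemma p_integralMz r x y : x \is a Num.int -> p_integral r y -> p_integral r (x * y).
Proof. by move=> xZ [e re ey]; exists e; rewrite // mulrCA rpredM. Qed.

Lemma p_integralN r x : p_integral r x -> p_integral r (- x).
Proof. by rewrite -mulN1r; apply: p_integralMz; rewrite rpredN rpred1. Qed.

Lemma p_integralB r x y : p_integral r x -> p_integral r y -> p_integral r (x - y).
Proof. by move=> hx hy; apply: p_integralD => //; apply: p_integralN. Qed.

Lemma p_integral_gt_denq r (x : rat) : prime r -> (`|denq x| < r)%N -> p_integral r x.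
Proof.
move=> pr lt_dr; exists `|denq x|%N.
  rewrite prime_coprime //; apply/negP => /dvdn_leq.
  by rewrite absz_gt0 denq_neq0 leqNgt lt_dr => /(_ isT).
have -> : (`|denq x|%N)%:R * x = (numq x)%:~R.
  rewrite -[x in _ * x]divq_num_den mulrC -[(`|denq x|%N)%:R]/((`|denq x|%N%:Z)%:~R).
  by rewrite gez0_abs ?denq_ge0 // divfK // intr_eq0 denq_neq0.
exact: intr_int.
Qed.

Lemma dvdz_small_eq0 (m : nat) (z : int) : (m%:Z %| z)%Z -> (`|z| < m)%N -> z = 0.
Proof.
rewrite dvdzE /= => dv lt_m; apply/eqP; rewrite -absz_eq0.
by move: dv lt_m; case: (absz z) => // n /dvdn_leq; lia.
Qed.

(** With [dvdz_small_eq0], this turns a congruence between sums of two small coefficients into an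
    equality. *)
Lemma absz_lt_of_quarter (m : nat) (x y x' y' : int) :
  (4 * `|x| < m)%N -> (4 * `|y| < m)%N -> (4 * `|x'| < m)%N -> (4 * `|y'| < m)%N ->
  (`|(x + y - (x' + y'))%R| < m)%N.
Proof. lia. Qed.

(** * The sequences, the betas and their size *)

Section AlmostACCP.

Variables p q : nat -> nat.
Hypothesis p_prime : forall n, prime (p n).
Hypothesis q_prime : forall n, prime (q n).
Hypothesis q_gt : (100 < q 0)%N.
Hypothesis pq_lt : forall n, (q n < p n)%N /\ (p n < q n.+1)%N.
Hypothesis alpha0_lt : alpha p q 0 < 1 / 200.
Hypothesis alpha_half : forall n, alpha p q n.+1 < alpha p q n / 2.

Let a := alpha p q.

Definition beta l : rat := 1 - \sum_(i <- iota 0 l) a i.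

Definition rsum (bs s : seq nat) : rat := \sum_(b <- bs) beta b + \sum_(i <- s) a i.

Definition wf (s : seq nat) : bool := (s == [::]) || ~~ uniq s.

(* The exponent of [X^(alpha i)] in a representation of an element of M. *)
Definition cf (i : nat) (bs s : seq nat) : int :=
  (count_mem i s)%:Z - (count (fun b => (i < b)%N) bs)%:Z.

Local Notation M := (gen_submonoid (Mgen p q)).

Lemma p_gt0 i : (0 < p i)%N. Proof. exact: prime_gt0. Qed.
Lemma q_gt0 i : (0 < q i)%N. Proof. exact: prime_gt0. Qed.

Lemma alpha_gt0 i : 0 < a i.
Proof. by rewrite divr_gt0 // ltr0n ?p_gt0 ?q_gt0. Qed.

Lemma alpha_q i : (p i)%:R * a i = (q i)%:R.
Proof. by rewrite mulrC divfK // pnatr_eq0 -lt0n p_gt0. Qed.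

Lemma q_ge i : (100 + i < q i)%N.
Proof. by elim: i => [|i IH]; [rewrite addn0 | have := pq_lt i; lia]. Qed.

Lemma p_ge i : (100 + i < p i)%N.
Proof. by have := pq_lt i; have := q_ge i; lia. Qed.

Lemma p_mono i j : (i < j)%N -> (p i < p j)%N.
Proof.
elim: j => // j IH; rewrite ltnS leq_eqVlt => /predU1P[->|/IH];
  have := pq_lt j; have := pq_lt j.+1; lia.
Qed.

Lemma p_neq i j : i != j -> p i != p j.
Proof. by case: ltngtP => // /p_mono; case: ltngtP. Qed.

Lemma alpha_le i j : (i <= j)%N -> a j <= a i.
Proof.
elim: j => [|j IH]; first by rewrite leqn0 => /eqP->.
rewrite leq_eqVlt => /predU1P[-> //|/IH le_ij].
by apply: le_trans le_ij; apply/ltW/(lt_le_trans (alpha_half j));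
   have := alpha_gt0 j; rewrite /a; lra.
Qed.

(** The sum telescopes: halving gives [a i <= 2 * a i - 2 * a i.+1]. *)
Lemma sum_alpha_le l : \sum_(i <- iota 0 l) a i <= 2 * a 0 - 2 * a l.
Proof.
elim: l => [|l IH]; first by rewrite big_nil; lra.
rewrite -addn1 iotaD big_cat /= big_seq1 add0n addn1.
by move: IH (alpha_half l); rewrite -/a; lra.
Qed.

Lemma beta_ge l : 99 / 100 <= beta l.
Proof.
by have := sum_alpha_le l; have := alpha_gt0 l; have := alpha0_lt; rewrite /beta -/a; lra.
Qed.

Lemma sum_alpha_ge0 s : 0 <= \sum_(i <- s) a i.
Proof. by apply: sumr_ge0 => i _; apply/ltW/alpha_gt0. Qed.

Lemma sum_beta_ge bs : (size bs)%:R * (99 / 100) <= \sum_(b <- bs) beta b.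
Proof.
elim: bs => [|b bs IH]; first by rewrite big_nil mul0r.
by rewrite big_cons /= -natr1 mulrDl; have := beta_ge b; lra.
Qed.

Lemma count_alpha_le i s : (count_mem i s)%:R * a i <= \sum_(j <- s) a j.
Proof.
elim: s => [|j s IH]; first by rewrite big_nil mul0r.
rewrite big_cons /= natrD mulrDl; apply: lerD => //.
by case: eqP => [->|_]; rewrite ?mul1r ?mul0r //; apply/ltW/alpha_gt0.
Qed.

(** * Coefficients determined modulo [p i] *)

Lemma p_integral_alpha i j : i != j -> p_integral (p i) (a j).
Proof.
move=> neq_ij; exists (p j); last by rewrite alpha_q natr_int.
by rewrite prime_coprime // dvdn_prime2 // p_neq.
Qed.

(** The prime [q i] differs from [p i], so it is invertible modulo [p i] and only [c] can cancel the
    denominator of [a i]. *)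
Lemma p_integral_alpha_dvd i (c : int) :
  p_integral (p i) (c%:~R * a i) -> ((p i)%:Z %| c)%Z.
Proof.
move=> [d pd /intrP[z Ez]].
have E : d%:Z * c * (q i)%:Z = z * (p i)%:Z.
  apply: (@intr_inj rat); rewrite !rmorphM /= -Ez -[(q i)%:~R]/((q i)%:R : rat).
  by rewrite -alpha_q -!pmulrn; ring.
have : ((p i)%:Z %| d%:Z * c * (q i)%:Z)%Z by rewrite E dvdz_mull.
rewrite Gauss_dvdzl; last first.
  rewrite coprimezE /= prime_coprime // dvdn_prime2 // neq_ltn.
  by have [-> _] := pq_lt i; rewrite orbT.
by rewrite Gauss_dvdzr // coprimezE.
Qed.

Lemma p_integral_sum_alpha i s :
  p_integral (p i) (\sum_(j <- s) a j - (count_mem i s)%:R * a i).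
Proof.
elim: s => [|j s IH]; first by rewrite big_nil mul0r subrr; apply: p_integral_int; rewrite rpred0.
rewrite big_cons /= natrD mulrDl.
have -> u v w x : u + v - (w + x) = u - w + (v - x) :> rat by ring.
apply: p_integralD => //; case: (eqVneq j i) => [->|ne_ji].
  by rewrite mul1r subrr; apply: p_integral_int; rewrite rpred0.
by rewrite mul0r subr0; apply: p_integral_alpha; rewrite eq_sym.
Qed.

Lemma count_iota0 i l : count_mem i (iota 0 l) = (i < l)%N.
Proof. by rewrite count_uniq_mem ?iota_uniq // mem_iota. Qed.

(** Modulo [p i]-integral numbers only [a i] survives: the other alphas have denominators prime to
    [p i], and each [beta b] with [i < b] contributes one [- a i]. *)
Lemma p_integral_rsum i bs s :
  p_integral (p i) (rsum bs s - (cf i bs s)%:~R * a i).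
Proof.
rewrite /rsum /cf.
have -> : \sum_(b <- bs) beta b + \sum_(j <- s) a j -
   ((count_mem i s)%:Z - (count (fun b => (i < b)%N) bs)%:Z)%:~R * a i =
   (\sum_(b <- bs) beta b + (count (fun b => (i < b)%N) bs)%:R * a i) +
   (\sum_(j <- s) a j - (count_mem i s)%:R * a i).
  by rewrite rmorphB /= -!pmulrn; ring.
apply: p_integralD; last exact: p_integral_sum_alpha.
elim: bs => [|b bs IH]; first by rewrite big_nil mul0r addr0; apply: p_integral_int; rewrite rpred0.
rewrite big_cons /= natrD mulrDl addrACA; apply: p_integralD => //.
rewrite /beta -count_iota0.
have -> u v w : u - v + w = u - (v - w) :> rat by ring.
apply: p_integralB; first by apply: p_integral_int; rewrite rpred1.
exact: p_integral_sum_alpha.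
Qed.

Lemma cf_dvd_of_p_integral i bs s :
  p_integral (p i) (rsum bs s) -> ((p i)%:Z %| cf i bs s)%Z.
Proof.
move=> h; apply: p_integral_alpha_dvd.
rewrite -[X in p_integral _ X](subKr (rsum bs s)).
by apply: p_integralB => //; apply: p_integral_rsum.
Qed.

Lemma rsum_cat bs s bs' s' : rsum (bs ++ bs') (s ++ s') = rsum bs s + rsum bs' s'.
Proof. by rewrite /rsum !big_cat /= addrACA. Qed.

Lemma cf_cat i bs s bs' s' : cf i (bs ++ bs') (s ++ s') = cf i bs s + cf i bs' s'.
Proof. by rewrite /cf !count_cat !PoszD; ring. Qed.

Lemma cf_dvd_of_eq i bs s bs' s' :
  rsum bs s = rsum bs' s' -> ((p i)%:Z %| cf i bs s - cf i bs' s')%Z.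
Proof.
move=> E; apply: p_integral_alpha_dvd.
have -> : (cf i bs s - cf i bs' s')%:~R * a i =
  (rsum bs' s' - (cf i bs' s')%:~R * a i) - (rsum bs s - (cf i bs s)%:~R * a i).
  by rewrite E rmorphB /=; ring.
by apply: p_integralB; apply: p_integral_rsum.
Qed.


(** * Representations of the elements of M *)

Lemma wf_cat s s' : wf s -> wf s' -> wf (s ++ s').
Proof.
move=> /predU1P[-> //|/negbTE us] _.
by rewrite /wf cat_uniq us orbT.
Qed.

Lemma wf_catr s s' : uniq (s ++ s') -> wf s' -> s' = [::].
Proof. by rewrite cat_uniq => /and3P[_ _ us'] /predU1P[//|]; rewrite us'. Qed.

Lemma nonuniq_perm (T : eqType) (s : seq T) :
  ~~ uniq s -> exists j s', perm_eq s (j :: j :: s').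
Proof.
elim: s => //= x s IH; rewrite negb_and negbK => /orP[xs|/IH[j [s' ps]]].
  by exists x, (rem x s); rewrite perm_cons perm_to_rem.
exists j, (x :: s'); rewrite -(perm_cons x) in ps; apply: (perm_trans ps).
by rewrite -[x :: j :: _]/([:: x] ++ [:: j; j] ++ s') perm_catCA.
Qed.

(** Induction on the length of [s]. If [s] has no repetition, the sum is a generator in [A3] or
    [A2], according to whether [j] occurs in [s]; otherwise two equal entries [k] split off as
    [2 * a k]. *)
Lemma M_double j s : M (2 * a j + \sum_(i <- s) a i).
Proof.
have M2 i : M (2 * a i).
  apply: gsm_gen; left; exists [:: i], i; rewrite ?mem_seq1 //.
  by rewrite big_seq1 -/a; split => //; ring.
have [n] := ubnP (size s); elim: n j s => // n IH j s le_n.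
case: (boolP (uniq s)) => [us|/nonuniq_perm[k [s' ps]]].
  apply: gsm_gen; case: (boolP (j \in s)) => js.
    by right; left; exists s, j.
  left; exists (j :: s), j; first by rewrite mem_head.
  by rewrite /= js us big_cons -/a; split => //; ring.
rewrite (perm_big _ ps) /= !big_cons addrCA.
rewrite -/a; have -> u v w : u + (v + (u + w)) = 2 * u + (v + w) :> rat by ring.
apply: gsm_add; first exact: M2.
by apply: IH; move/perm_size: ps le_n => /= ->; lia.
Qed.

Lemma M_sum_alpha s : wf s -> M (\sum_(i <- s) a i).
Proof.
case/predU1P => [->|/nonuniq_perm[k [s' ps]]]; first by rewrite big_nil; apply: gsm0.
rewrite (perm_big _ ps) /= !big_cons addrA -mulr2n -mulr_natl.
exact: M_double.
Qed.

Lemma betaE l : beta l = 1 - \sum_(i < l) a i.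
Proof. by rewrite -(big_mkord xpredT) /index_iota subn0. Qed.

Lemma M_beta l : M (beta l).
Proof. by apply: gsm_gen; right; right; exists l; rewrite betaE. Qed.

Lemma M_sum_beta bs : M (\sum_(b <- bs) beta b).
Proof.
elim: bs => [|b bs IH]; first by rewrite big_nil; apply: gsm0.
by rewrite big_cons; apply: gsm_add => //; apply: M_beta.
Qed.

Lemma M_rsum bs s : wf s -> M (rsum bs s).
Proof. by move=> ws; apply: gsm_add; [apply: M_sum_beta | apply: M_sum_alpha]. Qed.

Lemma M_ex_rsum x : M x -> exists bs s, wf s /\ x = rsum bs s.
Proof.
elim=> {x}[|x Gx|x y _ [bs [s [ws ->]]] _ [bs' [s' [ws' ->]]]].
- by exists [::], [::]; rewrite /rsum !big_nil addr0.
- case: Gx => [[s [j js [us ->]]]|[[s [j js [us ->]]]|[l ->]]].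
  + exists [::], (j :: s); split; first by rewrite /wf /= js.
    by rewrite /rsum big_nil add0r big_cons.
  + exists [::], (j :: j :: s); split; first by rewrite /wf /= mem_head.
    by rewrite /rsum big_nil add0r !big_cons -/a; ring.
  + exists [:: l], [::]; split=> //.
    by rewrite /rsum big_nil addr0 big_seq1 betaE.
- exists (bs ++ bs'), (s ++ s'); split; first exact: wf_cat.
  by rewrite rsum_cat.
Qed.

Lemma rsum_ge bs s : (size bs)%:R * (99 / 100) <= rsum bs s.
Proof. by have := sum_beta_ge bs; have := sum_alpha_ge0 s; rewrite /rsum -/a; lra. Qed.

Lemma sum_alpha_le_rsum bs s : \sum_(i <- s) a i <= rsum bs s.
Proof. by have := sum_beta_ge bs; have := ler0n rat (size bs); rewrite /rsum -/a; lra. Qed.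

Lemma M_ge0 x : M x -> 0 <= x.
Proof.
case/M_ex_rsum => bs [s [_ ->]]; have := rsum_ge bs s.
by have := ler0n rat (size bs); lra.
Qed.

Lemma count_lt_p i s : \sum_(j <- s) a j < (q i)%:R -> (count_mem i s < p i)%N.
Proof.
move=> lt_q; have := le_lt_trans (count_alpha_le i s) lt_q.
by rewrite -alpha_q ltr_pM2r ?alpha_gt0 // ltr_nat.
Qed.

(** The multiplicity of [i] is divisible by [p i], yet smaller than [p i] because [p i] copies of
    [a i] already add up to [q i]. *)
Lemma notin_of_p_integral i s :
  p_integral (p i) (\sum_(j <- s) a j) -> \sum_(j <- s) a j < (q i)%:R -> i \notin s.
Proof.
move=> hs /count_lt_p lt_p; have := @cf_dvd_of_p_integral i [::] s.
rewrite /rsum big_nil add0r => /(_ hs); rewrite /cf /= subr0 dvdzE /= => dv.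
apply/count_memPn; move: dv lt_p.
case: (count_mem i s) => // n /dvdn_leq; lia.
Qed.

Lemma alpha_le_sum I s :
  s != [::] -> (forall i, (I <= i)%N -> i \notin s) -> a I <= \sum_(i <- s) a i.
Proof.
case: s => // j s _ h; rewrite big_cons.
have lt_jI : (j < I)%N by rewrite ltnNge; apply/negP => /h; rewrite mem_head.
by have := alpha_le (ltnW lt_jI); have := sum_alpha_ge0 s; rewrite -/a; lra.
Qed.

(** * Elements whose nonzero divisors are bounded below *)

(** This is all that the ACCP argument asks of one exponent of the polynomial. *)
Definition coarse (t : rat) : Prop :=
  exists2 eps : rat, 0 < eps &
    forall v w, M v -> M w -> t = v + w -> v != 0 -> eps <= v.

Lemma coarse_of_no_beta t :
  (forall l w, M w -> t <> beta l + w) -> coarse t.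
Proof.
(* From [I] on, [p i] exceeds the denominator of [t] and [q i] exceeds [t], so no [a i] with
   [I <= i] enters a representation of [t] by alphas. *)
move=> nob; pose I := (`|denq t| + Num.bound t)%N.
exists (a I); first exact: alpha_gt0.
have sumonly v w : M v -> M w -> t = v + w ->
    exists2 s, wf s & v = \sum_(i <- s) a i.
  move=> /M_ex_rsum[[|b bs] [s [ws Ev]]] Mw Et.
    by exists s; rewrite // Ev /rsum big_nil add0r.
  case: (nob b (rsum bs s + w)); first by apply: gsm_add => //; apply: M_rsum.
  by rewrite Et Ev /rsum big_cons !addrA.
move=> v w Mv Mw Et v0.
have [s ws Ev] := sumonly v w Mv Mw Et.
have [s' ws' Ew] := sumonly w v Mw Mv (etrans Et (addrC _ _)).
have Es : t = \sum_(i <- s ++ s') a i by rewrite big_cat /= Et Ev Ew.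
rewrite Ev; apply: alpha_le_sum.
  by apply: contraNneq v0 => s0; rewrite Ev s0 big_nil.
move=> i le_Ii; have : i \notin s ++ s'.
  apply: notin_of_p_integral; rewrite -Es.
    by apply: p_integral_gt_denq => //; have := p_ge i; lia.
  have t0 : 0 <= t by rewrite Es; apply: sum_alpha_ge0.
  apply: (lt_le_trans (archi_boundP t0)); rewrite ler_nat.
  by have := q_ge i; lia.
by rewrite mem_cat negb_or => /andP[].
Qed.

Lemma beta_atom l v w : M v -> M w -> beta l = v + w -> v = 0 \/ w = 0.
Proof.
have b_le1 : beta l <= 1 by have := sum_alpha_ge0 (iota 0 l); rewrite /beta -/a; lra.
move=> /M_ex_rsum[bs [s [ws Ev]]] /M_ex_rsum[bs' [s' [ws' Ew]]] E.
have Er : rsum [:: l] [::] = rsum (bs ++ bs') (s ++ s').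
  by rewrite rsum_cat -Ev -Ew -E /rsum big_seq1 big_nil addr0.
have le1 : (size (bs ++ bs') <= 1)%N.
  have := rsum_ge (bs ++ bs') (s ++ s'); rewrite -Er /rsum big_seq1 big_nil addr0.
  case: (size _) => [|[|n]] //; have := ler0n rat n; rewrite -2!natr1; lra.
(* The margin 2 absorbs the at most one beta on either side, so that the congruence of coefficients
   becomes an equality. *)
have cnt i : (count_mem i (s ++ s') + 2 < p i)%N.
  have : \sum_(j <- s ++ s') a j <= 1.
    apply: le_trans b_le1; rewrite -[beta l]/(beta l) E Ev Ew -rsum_cat.
    exact: sum_alpha_le_rsum.
  move/(le_trans (count_alpha_le i _)) => c1.
  rewrite -(ltr_nat rat) -(ltr_pM2r (alpha_gt0 i)) alpha_q natrD mulrDl.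
  apply: le_lt_trans (_ : 1 + 2%:R * a i < _).
    by rewrite lerD2r.
  have : (100 : rat) < (q i)%:R by rewrite ltr_nat; have := q_ge i; lia.
  have := alpha_le (leq0n i); have := alpha0_lt; rewrite -/a; lra.
have cfE i : cf i [:: l] [::] = cf i (bs ++ bs') (s ++ s').
  apply/eqP; rewrite -subr_eq0; apply/eqP/(dvdz_small_eq0 (cf_dvd_of_eq i Er)).
  have := count_size (fun b => (i < b)%N) (bs ++ bs'); have := cnt i.
  by rewrite /cf /= addn0; move: le1; case: (i < l)%N => /=; lia.
case Ebs : (bs ++ bs') le1 cfE => [|b [|//]] _ cfE.
  (* Without a beta on the right the multiplicity of [i] would be [- (i < l)], never positive, so no
     alpha occurs. *)
  have s0 : s ++ s' = [::].
    case: (s ++ s') cfE => // j t /(_ j); rewrite /cf /= eqxx; lia.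
  by left; case: bs s {Ev ws E Er cnt cfE} s0 Ebs Ev => [|? ?] [|? ?] //= _ _ ->;
    rewrite /rsum !big_nil addr0.
(* The multiplicity of [i] is now [(i < b) - (i < l)], at most 1. Without repetitions [wf] forces
   [s] and [s'] to be empty, and the single beta lies in one of the summands. *)
have us : uniq (s ++ s').
  apply: count_mem_uniq => i; have := cfE i; rewrite /cf /= -has_pred1 has_count.
  by case: (count_mem i _) => [|[|n]] //; lia.
have s'0 := wf_catr us ws'.
have s0 : s = [::] by rewrite s'0 cats0 in us; move: ws; rewrite /wf us orbF => /eqP.
case: bs {E Er cnt cfE} Ebs Ev => [|? bs] /= Ebs Ev.
  by left; rewrite Ev s0 /rsum !big_nil addr0.
by right; case: bs bs' Ebs Ew {Ev} => [|//] [|//] _ ->; rewrite s'0 /rsum !big_nil addr0.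
Qed.

Lemma beta_gt0 l : 0 < beta l.
Proof. by have := beta_ge l; lra. Qed.

Lemma coarse_beta l : coarse (beta l).
Proof.
exists (beta l); first exact: beta_gt0.
move=> v w Mv Mw E v0; case: (beta_atom Mv Mw E) => [/eqP|w0].
  by rewrite (negbTE v0).
by rewrite E w0 addr0.
Qed.

(** * Extracting a common multiple of one beta *)

(** The betas counted here may be distinct; [beta_divides_sub] trades them for copies of a single
    late beta. *)
Definition beta_divides (k : nat) (t : rat) : Prop :=
  exists bs s, [/\ wf s, (k <= size bs)%N & t = rsum bs s].

Lemma sum_betaE bs l : (forall b, b \in bs -> (b <= l)%N) ->
  \sum_(b <- bs) beta b =
  (size bs)%:R * beta l + \sum_(i <- flatten [seq iota b (l - b) | b <- bs]) a i.
Proof.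
elim: bs => [|b bs IH] hl; first by rewrite !big_nil mul0r addr0.
rewrite big_cons /= big_cat /= IH; last by move=> c cb; apply: hl; rewrite inE cb orbT.
have le_bl : (b <= l)%N by apply: hl; rewrite mem_head.
have -> : beta b = beta l + \sum_(i <- iota b (l - b)) a i.
  have El : iota 0 l = iota 0 b ++ iota b (l - b) by rewrite -[b in iota b _]add0n -iotaD subnKC.
  by rewrite /beta El big_cat /=; ring.
by rewrite -natr1; ring.
Qed.

(** Passing from [beta b] to [beta l] frees the alphas with indices from [b] to [l - 1]. The new
    sequence of alphas satisfies [wf]: two betas both free the index [l - 1], and beside a lone beta
    [s] already repeats an index, as [t] is not a beta. *)
Lemma beta_divides_sub k t : beta_divides k t -> (forall l, t <> beta l) ->
  exists L, forall l, (L <= l)%N -> M (t - k%:R * beta l).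
Proof.
case: k => [|k] [bs [s [ws le_k ->]]] nob.
  by exists 0%N => l _; rewrite mul0r subr0; apply: M_rsum.
(* The successor makes every [b] strictly smaller than [l], so that each beta does free the index
   [l.-1]. *)
exists (\max_(b <- bs) b).+1 => l lt_l.
have lt_bl b : b \in bs -> (b < l)%N.
  by move=> bb; apply: leq_ltn_trans lt_l; exact: (@leq_bigmax_seq _ bs xpredT id b bb).
rewrite /rsum (@sum_betaE bs l) => [|b /lt_bl/ltnW //].
set fs := flatten _.
have -> : (size bs)%:R * beta l + \sum_(i <- fs) a i + \sum_(i <- s) a i -
    k.+1%:R * beta l = rsum (nseq (size bs - k.+1) l) (fs ++ s).
  rewrite /rsum big_nseq big_cat /= iter_addr_0 -[beta l *+ _]mulr_natl natrB //; ring.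
apply: M_rsum; rewrite /wf; case: bs le_k {lt_l} lt_bl nob @fs => //= b [|b' bs] _ lt_bl nob /=.
  rewrite cats0; case/predU1P: ws nob => [-> /(_ b)|];
    first by rewrite /rsum big_seq1 big_nil addr0.
  by move=> us _; rewrite cat_uniq (negbTE us) !andbF orbT.
have lb : (b < l)%N by apply: lt_bl; rewrite mem_head.
have lb' : (b' < l)%N by apply: lt_bl; rewrite !inE eqxx orbT.
have mem_pred c : (c < l)%N -> count_mem l.-1 (iota c (l - c)) = 1%N.
  by move=> lt_cl; rewrite count_uniq_mem ?iota_uniq // mem_iota; case: leqP; lia.
apply/orP; right; apply/negP => /(count_uniq_mem l.-1).
by rewrite !count_cat !mem_pred //; case: (_ \in _).
Qed.

Lemma beta_divides_add k l m w : M w -> beta_divides k.+1 (k%:R * beta l + (beta m + w)).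
Proof.
move=> /M_ex_rsum[bs [s [ws ->]]]; exists (nseq k l ++ m :: bs), s; split => //.
  by rewrite size_cat size_nseq /=; lia.
by rewrite /rsum big_cat big_cons big_nseq /= iter_addr_0 -[beta l *+ _]mulr_natl !addrA.
Qed.

Lemma beta_divides_le k t : beta_divides k t -> k%:R * (99 / 100) <= t.
Proof.
case=> bs [s [ws le_k ->]]; apply: le_trans (rsum_ge bs s).
by apply: ler_wpM2r; [lra | rewrite ler_nat].
Qed.

Lemma ex_uniform_threshold (T : eqType) (P : T -> nat -> Prop) (s : seq T) :
  (forall x, x \in s -> exists L, forall l, (L <= l)%N -> P x l) ->
  exists L, forall x, x \in s -> forall l, (L <= l)%N -> P x l.
Proof.
elim: s => [|x s IH] h; first by exists 0%N.
have [L1 h1] := h x (mem_head _ _).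
have [|L2 h2] := IH; first by move=> y ys; apply: h; rewrite inE ys orbT.
exists (maxn L1 L2) => y; rewrite inE => /predU1P[->|ys] l; rewrite geq_max => /andP[l1 l2].
  exact: h1.
exact: h2.
Qed.

Lemma common_beta_multiple (T : seq rat) :
  T != [::] -> (forall t, t \in T -> M t) ->
  (forall t, t \in T -> forall l, t <> beta l) ->
  exists k l, (forall t, t \in T -> M (t - k%:R * beta l)) /\
    exists2 t, t \in T & coarse (t - k%:R * beta l).
Proof.
move=> T0 MT nob.
pose P k := forall t, t \in T -> beta_divides k t.
have [k [Pk nPk]] : exists k, P k /\ ~ P k.+1.
  apply: NNPP => h.
  have Pall k : P k.
    elim: k => [|k Pk].
      by move=> t /MT /M_ex_rsum[bs [s [ws ->]]]; exists bs, s.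
    by apply: NNPP => nP; apply: h; exists k.
  case: T T0 MT nob @P h Pall => // t T _ MT _ P _ Pall.
  have t_ge0 := M_ge0 (MT _ (mem_head _ _)).
  (* The factor 2 outweighs the 99/100 lost per beta, so this many betas exceed [t]. *)
  have := beta_divides_le (Pall (2 * Num.bound t)%N _ (mem_head _ _)).
  have := archi_boundP t_ge0; rewrite natrM; lra.
have [L hL] := @ex_uniform_threshold _ (fun t l => M (t - k%:R * beta l)) T
  (fun t tT => beta_divides_sub (Pk t tT) (nob t tT)).
exists k, L; split; first by move=> t tT; apply: hL.
(* If no remainder were coarse, each would be divisible by a further beta, against the maximality of
   [k]. *)
apply: NNPP => h; apply: nPk => t tT; apply: NNPP => nk; apply: h.
exists t => //; apply: coarse_of_no_beta => l w Mw E; apply: nk.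
rewrite -[t](subrK (k%:R * beta L)) E addrC; exact: beta_divides_add.
Qed.

(** * Chains of divisors in F[M] *)

Variable F : fieldType.
Implicit Types f g y z : QAlg F.

Local Notation H := (@nonzero_monoid_alg F M).

Let M0 : M 0 := gsm0 _.
Let MD : forall v w, M v -> M w -> M (v + w) := @gsm_add _.

(** A fixed choice of representations makes [cf i] a function on [M]; in general it is independent
    of the choice only modulo [p i]. *)
Lemma ex_rsum_fun : exists R : rat -> seq nat * seq nat,
  forall u, M u -> u = rsum (R u).1 (R u).2.
Proof.
have ex u : exists r : seq nat * seq nat, M u -> u = rsum r.1 r.2.
  case: (classic (M u)) => [|nMu]; last by exists ([::], [::]).
  by move=> /M_ex_rsum[bs [s [_ E]]]; exists (bs, s).
exists (fun u => proj1_sig (constructive_indefinite_description _ (ex u))) => u.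
exact: proj2_sig (constructive_indefinite_description _ (ex u)).
Qed.

(** At most [2 * D] betas fit below [D], and the multiplicity of [i] is at most [D / a i], which is
    below [p i / 8] since [8 * D < q i]. *)
Lemma cf_small i D bs s :
  rsum bs s <= D%:R -> (8 * D < q i)%N -> (4 * `|cf i bs s| < p i)%N.
Proof.
move=> le_D lt_q; have [lt_qp _] := pq_lt i.
have le_bs : (size bs <= 2 * D)%N.
  rewrite -(ler_nat rat) natrM; have := rsum_ge bs s.
  by have := ler0n rat (size bs); lra.
have le_s : (8 * count_mem i s < p i)%N.
  rewrite -(ltr_nat rat) -(ltr_pM2r (alpha_gt0 i)) alpha_q //.
  apply: le_lt_trans (_ : (8 * D)%:R < _); last by rewrite ltr_nat.
  rewrite !natrM -mulrA ler_wpM2l //.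
  apply: le_trans (count_alpha_le i s) (le_trans _ le_D).
  exact: sum_alpha_le_rsum.
have := count_size (fun b => (i < b)%N) bs; move: le_bs le_s lt_q lt_qp; rewrite /cf; lia.
Qed.

Lemma exponent_le f y z D : H y -> H z -> f = y * z ->
  (forall t, t \in msupp f -> sval t <= D) ->
  (forall u, u \in msupp y -> sval u <= D) /\ (forall v, v \in msupp z -> sval v <= D).
Proof.
move=> [_ y0] [_ z0] Ef hD; have [u [v [uy vz uv hu hv]]] := msupp_extremal_deg y0 z0.
have := hD (mmul u v); rewrite Ef => /(_ uv) /= le_D.
have u0 := svalP u; have v0 := svalP v.
split=> [u' /hu | v' /hv] h; apply: le_trans h (le_trans _ le_D).
  by rewrite lerDl.
by rewrite lerDr.
Qed.

(* For [q i] large compared with the degree of [f], the coefficient [cf i] is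
   an additive weight on the supports of [y] and [z]; its maxima and its minima
   both add up to its value on the support of [f], namely 0. *)
Lemma p_integral_divisor f y z D i : H y -> H z -> f = y * z ->
  (forall t, t \in msupp f -> sval t <= D%:R) ->
  (forall t, t \in msupp f -> p_integral (p i) (sval t)) ->
  (8 * D < q i)%N -> (mone : qnn) \in msupp y ->
  forall u, u \in msupp y -> p_integral (p i) (sval u).
Proof.
move=> Hy Hz Ef hD hf lt_q y1 t ty.
have [yD zD] := exponent_le Hy Hz Ef hD.
have [My y0] := Hy; have [Mz z0] := Hz.
have [R hR] := ex_rsum_fun.
pose w (u : qnn) : int := cf i (R (sval u)).1 (R (sval u)).2.
have small u : M (sval u) -> sval u <= D%:R -> (4 * `|w u| < p i)%N.
  by move=> Mu le_D; apply: (@cf_small i D) => //; rewrite -hR.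
have p0 : (4 * `|0%R| < p i)%N by rewrite p_gt0.
have ysmall u (uy : u \in msupp y) := small u (My u uy) (yD u uy).
have zsmall u (uz : u \in msupp z) := small u (Mz u uz) (zD u uz).
have compat u v u' v' : u \in msupp y -> v \in msupp z -> u' \in msupp y -> v' \in msupp z ->
    sval u + sval v = sval u' + sval v' -> w u + w v = w u' + w v'.
  move=> uy vz u'y v'z.
  rewrite (hR _ (My u uy)) (hR _ (Mz v vz)) (hR _ (My u' u'y)) (hR _ (Mz v' v'z)).
  rewrite -!rsum_cat => /(cf_dvd_of_eq i).
  rewrite !cf_cat => /dvdz_small_eq0 E.
  apply/eqP; rewrite -subr_eq0; apply/eqP/E.
  exact: absz_lt_of_quarter (ysmall u uy) (zsmall v vz) (ysmall u' u'y) (zsmall v' v'z).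
have sum0 u v : u \in msupp y -> v \in msupp z -> mmul u v \in msupp (y * z) -> w u + w v = 0.
  move=> uy vz; rewrite -Ef => /hf /=; rewrite (hR _ (My u uy)) (hR _ (Mz v vz)).
  rewrite -rsum_cat => /(cf_dvd_of_p_integral).
  rewrite cf_cat => /dvdz_small_eq0; apply.
  by have := absz_lt_of_quarter (ysmall u uy) (zsmall v vz) p0 p0; rewrite addr0.
have [u [v [uy vz uv hu hv]]] := msupp_extremal y0 z0 compat.
have [|u' [v' [u'y v'z uv' hu' hv']]] := @msupp_extremal _ _ (fun k => - w k) y z y0 z0.
  by move=> u1 v1 u2 v2 h1 h2 h3 h4 /(compat _ _ _ _ h1 h2 h3 h4); rewrite -!opprD => ->.
have [Eu _] := eq_of_le_of_add (hu _ u'y) (hv _ v'z)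
  (etrans (sum0 _ _ u'y v'z uv') (esym (sum0 _ _ uy vz uv))).
have const k : k \in msupp y -> w k = w u.
  by move=> ky; apply/eqP; rewrite eq_le (hu _ ky) /= -Eu -lerN2; apply: hu'.
(* The constant term of [y] identifies the common value of [w] on its support. *)
have w1 : w mone = 0.
  apply: (@dvdz_small_eq0 (p i)); last first.
    by have := absz_lt_of_quarter (ysmall _ y1) p0 p0 p0; rewrite !addr0.
  apply: (cf_dvd_of_p_integral).
  by rewrite -hR //; apply: p_integral_int; rewrite rpred0.
have wt : w t = 0 by rewrite const // -(const mone).
have := p_integral_rsum i (R (sval t)).1 (R (sval t)).2.
by rewrite -/(w t) wt mul0r subr0 -hR //; apply: My.
Qed.

(** An exponent involving a beta exceeds 1/2; any other is a sum of alphas, all of index below [I]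
    by [p_integral_divisor]. *)
Lemma divisor_exponent_ge f y z D I : H y -> H z -> f = y * z ->
  (forall t, t \in msupp f -> sval t <= D%:R) ->
  (forall i, (I <= i)%N -> (8 * D < q i)%N /\
     forall t, t \in msupp f -> p_integral (p i) (sval t)) ->
  (mone : qnn) \in msupp y ->
  forall u, u \in msupp y -> sval u != 0 -> Num.min (a I) (1 / 2) <= sval u.
Proof.
move=> Hy Hz Ef hD hI y1 u uy u0.
have [yD _] := exponent_le Hy Hz Ef hD.
have [My _] := Hy; have [bs [s [ws Eu]]] := M_ex_rsum (My u uy).
rewrite ge_min; apply/orP; case: bs Eu => [|b bs] Eu; last first.
  right; have := rsum_ge (b :: bs) s.
  by rewrite /= Eu -natr1; have := ler0n rat (size bs); lra.
rewrite /rsum big_nil add0r in Eu.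
left; rewrite Eu; apply: alpha_le_sum => //.
  by apply: contraNneq u0 => s0; rewrite Eu s0 big_nil.
move=> i /hI[lt_q hf]; apply: notin_of_p_integral => //; rewrite -Eu.
  exact: (p_integral_divisor Hy Hz Ef hD hf lt_q y1 uy).
by apply: le_lt_trans (yD u uy) _; rewrite ltr_nat; lia.
Qed.

Lemma accpH_of_coarse f t0 :
  H f -> t0 \in msupp f -> coarse (sval t0) -> accpH H f.
Proof.
move=> Hf t0f [eps eps_gt0 heps] x Hx x0 xdvd.
have [D hD] : exists D : nat, forall t, t \in (msupp f : seq qnn) -> forall l, (D <= l)%N ->
    sval t <= l%:R /\ (`|denq (sval t)| <= l)%N.
  apply: ex_uniform_threshold => t _; exists (Num.bound (sval t) + `|denq (sval t)|)%N.
  move=> l le_l; split; last by lia.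
  by apply/ltW/(lt_le_trans (archi_boundP (svalP t))); rewrite ler_nat; lia.
have hDf t : t \in msupp f -> sval t <= D%:R by move=> tf; have [] := hD t tf D (leqnn D).
have hI i : (8 * D <= i)%N -> (8 * D < q i)%N /\
    forall t, t \in msupp f -> p_integral (p i) (sval t).
  move=> le_i; have := q_ge i; have := p_ge i; split; first by lia.
  by move=> t tf; apply: p_integral_gt_denq => //; have [_] := hD t tf D (leqnn D); lia.
pose delta := Num.min eps (Num.min (a (8 * D)) (1 / 2)).
have delta_gt0 : 0 < delta by rewrite !lt_min eps_gt0 alpha_gt0.
(* A potential: [t] is an exponent of [x n] dividing [t0] in [M], and [e] is the top exponent of
   [x n]. The bound on [t + e] persists along the chain and drops by [delta] at each strict step. *)
pose Inv n (mu : rat) := exists t e : qnn, [/\ t \in msupp (x n), M (sval t0 - sval t),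
  e \in msupp (x n), (forall u, u \in msupp (x n) -> sval u <= sval e) & sval t + sval e <= mu].
have InvS n mu : Inv n mu -> Inv n.+1 mu /\ (~ dvdH H (x n) (x n.+1) -> Inv n.+1 (mu - delta)).
  move=> [t [e [tx Mt ex he le_mu]]]; have [y Hy Ex] := xdvd n.
  have [w Hw Ef] : dvdH H (x n) f.
    rewrite -x0; elim: n {mu t e tx Mt ex he le_mu y Hy Ex} => [|n IH].
      exact: dvdH_refl.
    exact: dvdH_trans (xdvd n) IH.
  have [Mx' x'0] := Hx n.+1; have [My y0] := Hy.
  have [e' [v' [e'x v'y ev he' hv']]] := msupp_extremal_deg x'0 y0.
  have le_e : sval e' + sval v' <= sval e by apply: (he (mmul e' v')); rewrite Ex.
  move: (tx); rewrite Ex => /msuppM_le[t' [v [t'x vy Et]]].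
  have {}Et : sval t = sval t' + sval v by rewrite Et.
  have Mt' : M (sval t0 - sval t').
    have -> : sval t0 - sval t' = (sval t0 - sval t) + sval v by rewrite Et; ring.
    by apply: MD => //; apply: My.
  have v_ge0 : 0 <= sval v := svalP v; have v'_ge0 : 0 <= sval v' := svalP v'.
  split; first by exists t', e'; split => //; move: le_mu le_e Et v_ge0 v'_ge0; lra.
  move=> ndvd; exists t', e'; split => //.
  suff : delta <= sval v + sval v' by move: le_mu le_e Et; lra.
  (* A nonzero [v] divides [t0], so coarseness lowers [t]. If [v] is 0, then [y] has a constant term
     and, being a non-unit, lowers the top exponent instead. *)
  have [v0|v0] := eqVneq (sval v) 0; last first.
    have : eps <= sval v.
      apply: (heps _ (sval t0 - sval v)) => //; [exact: My | | by ring].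
      have -> : sval t0 - sval v = (sval t0 - sval t) + sval t' by rewrite Et; ring.
      by apply: MD => //; apply: Mx'.
    have : delta <= eps by rewrite ge_min lexx.
    by move: v'_ge0; lra.
  have vE : v = mone by apply: val_inj.
  have [u uy u0] : exists2 u, u \in msupp y & sval u != 0.
    apply: NNPP => h; apply: ndvd; have := @dvdH_unitM _ M (x n.+1) y; rewrite -Ex; apply.
    by apply: unitH_of_const => // u uy; apply/eqP/negP => /negP u0; apply: h; exists u.
  (* The factor [y] divides [f] itself, with cofactor [x n.+1 * w]. *)
  have Hz : H (x n.+1 * w) by apply: nonzero_monoid_algM.
  have Efy : f = y * (x n.+1 * w) by rewrite mulrA [y * _]mulrC -Ex.
  rewrite vE in vy.
  have := divisor_exponent_ge Hy Hz Efy hDf hI vy uy u0.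
  have : delta <= Num.min (a (8 * D)) (1 / 2) by rewrite ge_min lexx orbT.
  by move: (hv' _ uy); rewrite v0; lra.
have Inv_ge0 n mu : Inv n mu -> 0 <= mu.
  by move=> [t [e [_ _ _ _]]]; apply: le_trans; rewrite addr_ge0 ?(svalP t) ?(svalP e).
have InvD n j mu : Inv n mu -> Inv (n + j)%N mu.
  by move=> hn; elim: j => [|j /InvS[]]; rewrite ?addn0 ?addnS.
(* Since the potential is nonnegative, [B] bounds the number of strict steps still possible. *)
have stable B : forall n, Inv n (B%:R * delta) ->
    exists N, forall m, (N <= m)%N -> dvdH H (x m) (x m.+1).
  elim: B => [|B IH] n hn.
    exists n => m le_nm; apply: NNPP => ndvd.
    have /InvS[_ /(_ ndvd) /Inv_ge0] : Inv m (0%:R * delta) by rewrite -(subnKC le_nm); apply: InvD.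
    by rewrite mul0r; move: delta_gt0; lra.
  case: (classic (forall m, (n <= m)%N -> dvdH H (x m) (x m.+1))) => [|hndvd]; first by exists n.
  have [m le_nm ndvd] : exists2 m, (n <= m)%N & ~ dvdH H (x m) (x m.+1).
    by apply: NNPP => h; apply: hndvd => m le_nm; apply: NNPP => nd; apply: h; exists m.
  apply: (IH m.+1).
  have /InvS[_ /(_ ndvd)] : Inv m (B.+1%:R * delta) by rewrite -(subnKC le_nm); apply: InvD.
  by rewrite -natr1 mulrDl mul1r addrK.
have [e et0 he] : exists2 e, e \in (msupp f : seq qnn) &
    forall u, u \in (msupp f : seq qnn) -> sval u <= sval e.
  by apply: seq_max; apply: msupp_neq0; case: Hf.
have Inv0 : Inv 0%N ((Num.bound ((sval t0 + sval e) / delta))%:R * delta).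
  exists t0, e; rewrite x0 subrr; split => //.
  rewrite -ler_pdivrMr //; apply/ltW/archi_boundP.
  by apply: divr_ge0; [exact: addr_ge0 (svalP t0) (svalP e) | exact: ltW].
have [N hN] := stable _ _ Inv0.
exists N => n /subnKC<-; elim: (n - N)%N => [|j [le1 le2]].
  by rewrite addn0; split; apply: dvdH_refl.
rewrite addnS; split; first exact: dvdH_trans (xdvd _) le1.
by apply: dvdH_trans le2 _ => //; apply: hN; rewrite leq_addr.
Qed.

(** * The common atomic divisor *)

Lemma monoid_alg_almost_ACCP_Mgen : monoid_alg_almost_ACCP F M.
Proof.
move=> S S0 HS.
(* A beta is coarse, so an [s] with a beta among its exponents has the ACCP itself and the divisor 1
   suffices. *)
case: (classic (exists2 s, s \in S & exists2 t, t \in msupp s & exists l, sval t = beta l)).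
  move=> [s sS [t ts [l Et]]]; exists 1; split.
  - by split; [exact: nonzero_monoid_alg1 | left; apply: unitH1].
  - by move=> f fS; exists f; rewrite ?mul1r //; apply: HS.
  - exists s => //; exists s; first by rewrite mul1r; split => //; apply: HS.
    apply: (accpH_of_coarse (HS _ sS) ts).
    by rewrite Et; apply: coarse_beta.
move=> nobeta.
pose T := flatten [seq [seq sval t | t <- (msupp s : seq qnn)] | s <- S].
have inT s t : s \in S -> t \in msupp s -> sval t \in T.
  by move=> sS ts; apply/flatten_mapP; exists s => //; apply: map_f.
have Tin r : r \in T -> exists2 s, s \in S & exists2 t, t \in msupp s & r = sval t.
  by move=> /flatten_mapP[s sS /mapP[t ts ->]]; exists s => //; exists t.
have [k [l [MT [r rT cr]]]] : exists k l, (forall t, t \in T -> M (t - k%:R * beta l)) /\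
    exists2 t, t \in T & coarse (t - k%:R * beta l).
  apply: common_beta_multiple => //.
  - have [s sS] : exists s, s \in S by case: (S) S0 => // s S' _; exists s; apply: mem_head.
    have [_ s0] := HS s sS.
    have := msupp_neq0 s0; case E : (msupp s : seq qnn) => [//|t ts] _.
    have : t \in msupp s by rewrite -[t \in _]/(t \in (msupp s : seq qnn)) E mem_head.
    by move=> /(inT _ _ sS); apply: contraTneq => ->.
  - by move=> r /Tin[s sS [t ts ->]]; have [Ms _] := HS s sS; apply: Ms.
  - by move=> r /Tin[s sS [t ts ->]] j Et; apply: nobeta; exists s => //; exists t => //; exists j.
have beta0 := beta_gt0 l.
pose b : qnn := exist _ (beta l) (ltW beta0).
have atom_b : atomH H (monom F b).
  apply: atomH_monom => //=; [exact: M_beta | exact: lt0r_neq0 |].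
  by move=> v w; apply: beta_atom.
have [e Ee eat] := atomicH_monom_muln M0 MD k atom_b.
have factor s : s \in S -> exists2 c, H c & s = monom F e * c.
  move=> sS; have [Ms s0] := HS s sS.
  apply: (monom_factor Ee s0) => u us; have Mu := MT _ (inT _ _ sS us).
  by split => //; apply: M_ge0 Mu.
exists (monom F e); split => //.
have [s sS [t ts Er]] := Tin r rT.
have [c Hc Es] := factor s sS.
exists s => //; exists c => //.
(* Division by the monomial turns the exponent [r] of [s] into the coarse exponent [r - k * beta l]
   of [c]. *)
move: ts; rewrite Es => /msuppM_le[e' [t' [+ t'c Et]]].
rewrite monom_supp in_fset1 => /eqP Ee'; rewrite Ee' in Et.
apply: (accpH_of_coarse Hc t'c).
by move: cr; rewrite Er Et /= Ee addrAC subrr add0r.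
Qed.

End AlmostACCP.

Theorem theorem5p13 (p q : nat -> nat) :
  (forall n, prime (p n)) -> (forall n, prime (q n)) ->
  (forall n, (p n < p n.+1)%N) -> (forall n, (q n < q n.+1)%N) ->
  (100 < q 0)%N ->
  (forall n, (q n < p n)%N /\ (p n < q n.+1)%N) ->
  alpha p q 0 < 1 / 200 ->
  (forall n, alpha p q n.+1 < alpha p q n / 2) ->
  forall F : fieldType, monoid_alg_almost_ACCP F (gen_submonoid (Mgen p q)).
Proof.
move=> p_prime q_prime _ _ q_gt pq_lt alpha0_lt alpha_half F.
exact: monoid_alg_almost_ACCP_Mgen.
Qed.
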